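(* If $G$ is a cyclic group of order $p^n$, where $p$ is a prime and $n \geq 1$, then \[ M_1(\mathcal{B}(G))=\frac{p^{2n}(p^2+1)+p^{4n}(p^2-1)+2}{p^2+1}\quad\text{and}\quad M_2(\mathcal{B}(G))=\frac{p^{4n}(p^2-1)+2}{p^2+1}. \] Further, $\frac{M_{2}(\mathcal{B}(G))}{|e(\mathcal{B}(G))|} \geq \frac{M_{1}(\mathcal{B}(G))}{|V(\mathcal{B}(G))|}$.
   Context: For a finite group $G$, $L(G)$ denotes the set of all subgroups of $G$. The subgroup generating bipartite graph $\mathcal{B}(G)$ is the simple undirected bipartite graph whose vertex set is the disjoint union $(G\times G)\sqcup L(G)$, where $(a,b)\in G\times G$ and $H\in L(G)$ are adjacent if and only if $H=\langle a,b\rangle$ (the subgroup generated by $a$ and $b$); there are no other edges. For a finite simple graph $\mathcal{G}$ with vertex set $V(\mathcal{G})$ and edge set $e(\mathcal{G})$, the first and second Zagreb indices are $M_1(\mathcal{G})=\sum_{v\in V(\mathcal{G})}\deg(v)^2$ and $M_2(\mathcal{G})=\sum_{uv\in e(\mathcal{G})}\deg(u)\deg(v)$. *)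

(* Defs.v *)
From mathcomp Require Import all_boot all_order all_algebra all_fingroup all_solvable.

Set Implicit Arguments.
Unset Strict Implicit.
Unset Printing Implicit Defensive.

Record sgraph : Type := SGraph {
  vertex : finType;
  adj : rel vertex;
  adj_sym : symmetric adj;
  adj_irrefl : irreflexive adj }.

Definition deg (X : sgraph) (v : vertex X) : nat := #|[set u | adj v u]|.

(* An edge uv is the two-element set {u, v}, so each edge is counted once. *)
Definition edges (X : sgraph) : {set {set vertex X}} :=
  [set [set uv.1; uv.2] | uv : vertex X * vertex X & adj uv.1 uv.2].

Definition zagreb1 (X : sgraph) : nat := \sum_(v : vertex X) deg v ^ 2.

Definition zagreb2 (X : sgraph) : nat := \sum_(E in edges X) \prod_(v in E) deg v.

Section SubgroupGeneratingBipartiteGraph.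

Variables (gT : finGroupType) (G : {group gT}).

Definition sgb_vertex : finType :=
  ({ab : gT * gT | ab \in setX G G} + {H : {group gT} | H \in subgroups G})%type.

Definition generates (ab : gT * gT) (H : {group gT}) : bool :=
  H :==: <<[set ab.1; ab.2]>>%g.

Definition sgb_adj (x y : sgb_vertex) : bool :=
  match x, y with
  | inl ab, inr H | inr H, inl ab => generates (val ab) (val H)
  | _, _ => false
  end.

Lemma sgb_adj_sym : symmetric sgb_adj.
Proof. by case=> [ab|H] [cd|K]. Qed.

Lemma sgb_adj_irrefl : irreflexive sgb_adj.
Proof. by case. Qed.

Definition sgb_graph : sgraph := SGraph sgb_adj_sym sgb_adj_irrefl.

End SubgroupGeneratingBipartiteGraph.

(* Main.v *)
Require Import Defs.
From mathcomp Require Import all_boot all_order all_algebra all_fingroup all_solvable.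
From mathcomp Require Import ring.

Set Implicit Arguments.
Unset Strict Implicit.
Unset Printing Implicit Defensive.

Import Order.TTheory GRing.Theory Num.Theory.
Local Open Scope ring_scope.

(** Every pair (a, b) has exactly one neighbour, namely <<a, b>>, so all of
    the degree information lies in the numbers d(H) of pairs generating H; for
    any finite group G they satisfy

      sum of d(H) = |G|^2  over the subgroups H of G,

    because each pair generates exactly one of these subgroups. The edges
    correspond to the pairs, and the edge at a pair generating H contributes
    1 * d(H) to M_2, whence M_2 = sum of d(H)^2 and M_1 = |G|^2 + M_2
    ([zagreb2_sgb], [zagreb1_sgb]).

    If G is cyclic of order p^(n+1), it has a subgroup M of order p^n that
    contains all proper subgroups. Comparing the displayed identity for G and
    for M gives d(G) = p^(2n+2) - p^(2n), and since the remaining subgroups of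
    G are those of M, the sum of d(H)^2 follows by induction on n
    ([sum_sqr_npairs_cyclic]).

    The comparison of the averages holds for every finite group
    ([sgb_zagreb_mean]). With N = |G|^2 edges, N + m vertices and S = M_2, it
    says S / N >= (N + S) / (N + m), that is S m >= N^2, which is the
    Cauchy-Schwarz inequality for the m numbers d(H), whose sum is N. *)

(** * An inequality between sums *)

(** The Cauchy-Schwarz inequality against the constant function 1. *)
Lemma sum_leq_sqr (I : finType) (A : {pred I}) (f : I -> nat) :
  ((\sum_(i in A) f i) ^ 2 <= #|A| * \sum_(i in A) f i ^ 2)%N.
Proof.
rewrite -(leq_pmul2l (isT : 0 < 2)%N) -mulnn big_distrlr /= big_distrr /=.
(* The factor 2 allows each term of the double sum to be bounded by AM-GM. *)
apply: (@leq_trans (\sum_(i in A) \sum_(j in A) (f i ^ 2 + f j ^ 2))%N).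
  apply: leq_sum => i _; rewrite big_distrr /=.
  by apply: leq_sum => j _; apply: nat_Cauchy.
under eq_bigr do rewrite big_split /= sum_nat_const.
by rewrite big_split /= -big_distrr /= sum_nat_const mul2n addnn.
Qed.

(** * Generating pairs of subgroups *)

Section GeneratingPairs.

Variable gT : finGroupType.
Implicit Types G H K M : {group gT}.

(** Pairs are drawn from the whole type, as any pair generating [H] lies in [H]:
    the count does not mention a group [G] containing [H], so the sums for two
    different [G] have common terms. *)
Definition npairs H : nat := #|[set ab | generates ab H]|.

Lemma gen_pair_sub (ab : gT * gT) G :
  (<<[set ab.1; ab.2]>>%G \subset G) = (ab \in setX G G).
Proof. by case: ab => a b; rewrite gen_subG subUset !sub1set inE. Qed.

Lemma generatesE (ab : gT * gT) H :
  generates ab H = (<<[set ab.1; ab.2]>>%G == H).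
Proof. by rewrite eq_sym -val_eqE. Qed.

(** Grouping the pairs by the subgroup that they generate loses none of those
    counted by [npairs]: a pair generating a subgroup of [G] lies in [G]. *)
Lemma sum_generated (F : {group gT} -> nat) G :
  (\sum_(ab in setX G G) F <<[set ab.1; ab.2]>>%G
    = \sum_(H : {group gT} | H \subset G) npairs H * F H)%N.
Proof.
rewrite (partition_big (fun ab => <<[set ab.1; ab.2]>>%G)
                       (fun H : {group gT} => H \subset G)) /=; last first.
  by move=> ab; rewrite gen_pair_sub.
apply: eq_bigr => H sHG; rewrite -sum_nat_const.
apply: eq_big => [ab | ab /andP[_ /eqP-> //]].
rewrite inE generatesE -gen_pair_sub.
by case: eqP => [->|]; rewrite ?sHG ?andbF.
Qed.

Lemma sum_npairs G :
  (\sum_(H : {group gT} | H \subset G) npairs H = #|G| ^ 2)%N.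
Proof.
rewrite -mulnn -cardsX -sum1_card (sum_generated (fun=> 1%N)).
by apply: eq_bigr => H _; rewrite muln1.
Qed.

(** * Cyclic groups of prime power order *)

(** The subgroup of order [p ^ n] works because inclusion between subgroups of
    a cyclic group is divisibility of their orders, and the powers of [p] are
    totally ordered by divisibility. *)
Lemma cyclic_pgroup_largest_proper G p n :
    prime p -> cyclic G -> #|G| = (p ^ n.+1)%N ->
  exists2 M : {group gT}, [/\ M \subset G, #|M| = (p ^ n)%N & cyclic M] &
    forall H : {group gT}, (H \subset G) && (H != G) = (H \subset M).
Proof.
move=> p_pr cycG oG.
have [M sMG oM]: exists2 M : {group gT}, M \subset G & #|M| = (p ^ n)%N.
  have [x defG] := cyclicP cycG.
  exists <[(x ^+ p)%g]>%G; first by rewrite defG cycleX.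
  have ox : #[x]%g = (p ^ n.+1)%N by rewrite orderE -defG.
  by rewrite -orderE orderXdiv ox ?expnS ?dvdn_mulr ?mulKn ?prime_gt0.
exists M; first by split=> //; apply: cyclicS cycG.
move=> H; apply/andP/idP => [[sHG neHG] | sHM].
  rewrite -(cardSg_cyclic cycG) // oM.
  have: (#|H| %| p ^ n.+1)%N by rewrite -oG cardSg.
  case/(dvdn_pfactor _ _ p_pr) => k; rewrite leq_eqVlt ltnS.
  case/orP => [/eqP-> oH | le_kn ->]; last by rewrite dvdn_exp2l.
  by case/negP: neHG; rewrite -val_eqE eqEcard sHG oH oG /=.
split; first exact: subset_trans sHM sMG.
apply/eqP => eHG; have := subset_leq_card sHM.
by rewrite eHG oG oM leq_exp2l ?prime_gt1 // ltnn.
Qed.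

(** Both this sum and [sum_npairs] gain exactly the term of [G] when passing
    from the largest proper subgroup to [G]; the latter determines that term,
    and then the former is a geometric sum. *)
Lemma sum_sqr_npairs_cyclic (R : comNzRingType) G p n :
    prime p -> cyclic G -> #|G| = (p ^ n)%N ->
  let P : R := p%:R in
  (\sum_(H : {group gT} | H \subset G) npairs H ^ 2)%:R * (P ^+ 2 + 1)
    = P ^+ (4 * n) * (P ^+ 2 - 1) + 2.
Proof.
move=> p_pr cycG oG P; elim: n => [|n IHn] in G cycG oG *.
  have sG1 (H : {group gT}) : (H \subset G) = (H == G).
    have /eqP G1 : G :==: 1%g by rewrite trivg_card1 oG.
    by rewrite -val_eqE /= G1 subG1.
  have := sum_npairs G; rewrite !(eq_bigl _ _ sG1) !big_pred1_eq oG => ->.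
  by rewrite muln0 !exp1n expr0; ring.
have [M [sMG oM cycM] maxM] := cyclic_pgroup_largest_proper p_pr cycG oG.
have sum_maxM (F : {group gT} -> nat) : (\sum_(H : {group gT} | H \subset G) F H
    = F G + \sum_(H : {group gT} | H \subset M) F H)%N.
  by rewrite (bigD1 G) //= (eq_bigl _ _ maxM).
have := sum_npairs G; rewrite !sum_maxM sum_npairs oG oM.
move/(congr1 (fun k => k%:R : R)).
rewrite natrD !natrX -/P [P ^+ n.+1]exprS => dG.
rewrite natrD mulrDl IHn // natrX.
have -> : (npairs G)%:R = P ^+ n ^+ 2 * (P ^+ 2 - 1).
  by apply: (addIr ((P ^+ n) ^+ 2)); rewrite dG; ring.
by rewrite ![(4 * _)%N]mulnC !exprM [P ^+ n.+1]exprS; ring.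
Qed.

End GeneratingPairs.

(** * Zagreb indices of the subgroup generating bipartite graph *)

Section ZagrebIndices.

Variables (gT : finGroupType) (G : {group gT}).
Local Notation B := (sgb_graph G).
Local Notation pairs := {ab : gT * gT | ab \in setX G G}.
Local Notation subgrps := {H : {group gT} | H \in subgroups G}.

Lemma generated_subgroup (ab : pairs) :
  <<[set (val ab).1; (val ab).2]>>%G \in subgroups G.
Proof. by rewrite inE gen_pair_sub (valP ab). Qed.

Definition generated (ab : pairs) : subgrps :=
  exist (fun H => H \in subgroups G) _ (generated_subgroup ab).

Lemma generates_sval (ab : pairs) (H : subgrps) :
  generates (sval ab) (sval H) = (generated ab == H).
Proof. by rewrite generatesE. Qed.

Lemma deg_pair (ab : pairs) : deg (inl ab : vertex B) = 1%N.
Proof.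
rewrite /deg -(cards1 (inr (generated ab) : vertex B)); congr #|pred_of_set _|.
by apply/setP => -[cd|H]; rewrite !inE //= generates_sval eq_sym.
Qed.

Lemma deg_subgroup (H : subgrps) : deg (inr H : vertex B) = npairs (val H).
Proof.
have sHG : val H \subset G by have := valP H; rewrite inE.
rewrite /deg -sum1_card big_sumType /= [X in (_ + X)%N]big_pred0 ?addn0.
  rewrite (eq_bigl (fun ab : pairs => generates (val ab) (val H))).
    rewrite -(big_sub_cond (setX G G) (fun ab => generates ab (val H))
                           (fun=> 1%N)).
    rewrite /npairs -sum1_card; apply: eq_bigl => ab.
    rewrite inE -gen_pair_sub generatesE.
    by case: eqP => [->|]; rewrite ?sHG ?andbF.
  by move=> ab; rewrite inE.
by move=> K; rewrite inE.
Qed.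

Definition pair_edge (ab : pairs) : {set vertex B} :=
  [set inl ab; inr (generated ab)].

Lemma pair_edge_inj : injective pair_edge.
Proof.
move=> ab cd eq_e; have: inl ab \in pair_edge cd by rewrite -eq_e !inE eqxx.
by rewrite !inE orbF => /eqP[].
Qed.

(** An edge joins a pair to a subgroup, and the pair determines the subgroup;
    so the edges are parametrized by the pairs, bijectively by
    [pair_edge_inj]. *)
Lemma edges_sgb : edges B = [set pair_edge ab | ab : pairs].
Proof.
apply/setP => E; apply/imsetP/imsetP => [[[u v] adj_uv ->] | [ab _ ->]].
  move: adj_uv; rewrite inE /=; case: u v => [ab | H] [cd | K] //=.
    by rewrite generates_sval => /eqP <-; exists ab.
  by rewrite generates_sval => /eqP <-; exists cd; rewrite // /pair_edge setUC.
exists (inl ab, inr (generated ab)) => //.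
by rewrite inE; apply: eqxx.
Qed.

Lemma card_pairs : #|{: pairs}| = (#|G| ^ 2)%N.
Proof. by rewrite card_sig -mulnn -cardsX; apply: eq_card. Qed.

Lemma card_edges_sgb : #|edges B| = (#|G| ^ 2)%N.
Proof.
by rewrite edges_sgb card_imset ?card_pairs //; apply: pair_edge_inj.
Qed.

Lemma card_vertex_sgb : #|vertex B| = (#|G| ^ 2 + #|subgroups G|)%N.
Proof. by rewrite card_sum card_pairs card_sig; congr addn; apply: eq_card. Qed.

(** The vertices that are pairs have degree 1 and contribute [#|G| ^ 2]. *)
Lemma zagreb1_sgb :
  (zagreb1 B = #|G| ^ 2 + \sum_(H : {group gT} | H \subset G) npairs H ^ 2)%N.
Proof.
rewrite /zagreb1 big_sumType /=; congr addn.
  under eq_bigr do rewrite deg_pair exp1n.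
  by rewrite sum1_card card_pairs.
under eq_bigr do rewrite deg_subgroup.
rewrite -(big_sub (subgroups G) (fun H => npairs H ^ 2)%N).
by apply: eq_bigl => H; rewrite inE.
Qed.

(** A subgroup [H] is an endpoint of [npairs H] edges, and each of them
    contributes [1 * npairs H]. *)
Lemma zagreb2_sgb :
  (zagreb2 B = \sum_(H : {group gT} | H \subset G) npairs H ^ 2)%N.
Proof.
rewrite /zagreb2 edges_sgb big_imset /=; last first.
  by move=> ab cd _ _; apply: pair_edge_inj.
transitivity (\sum_(ab in setX G G) npairs <<[set ab.1; ab.2]>>%G)%N.
  rewrite (big_sub (setX G G) (fun ab => npairs <<[set ab.1; ab.2]>>%G)).
  apply: eq_bigr => ab _.
  by rewrite big_setU1 ?inE //= big_set1 deg_pair deg_subgroup mul1n.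
by rewrite sum_generated; apply: eq_bigr => H _; rewrite mulnn.
Qed.

(** After clearing denominators and cancelling [zagreb2 B * #|G| ^ 2], this is
    [sum_leq_sqr] for the function [npairs] on the subgroups of [G]. *)
Lemma sgb_zagreb_mean :
  (zagreb1 B)%:R / #|vertex B|%:R <= (zagreb2 B)%:R / #|edges B|%:R :> rat.
Proof.
rewrite zagreb1_sgb -zagreb2_sgb card_vertex_sgb card_edges_sgb.
have G2_gt0 : (0 < #|G| ^ 2)%N by rewrite expn_gt0 cardG_gt0.
rewrite ler_pdivrMr ?ltr0n ?addn_gt0 ?G2_gt0 // mulrAC ler_pdivlMr ?ltr0n //.
rewrite -!natrM ler_nat mulnDl mulnDr [(zagreb2 B * _)%N]mulnC.
rewrite [(zagreb2 B * _)%N]mulnC addnC leq_add2l.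
have := sum_leq_sqr (fun H : {group gT} => H \in subgroups G) (@npairs gT).
rewrite zagreb2_sgb mulnn.
have inG (H : {group gT}) : (H \in subgroups G) = (H \subset G) by rewrite inE.
by rewrite !(eq_bigl _ _ inG) sum_npairs.
Qed.

End ZagrebIndices.

Theorem theorem3p5 (gT : finGroupType) (G : {group gT}) (p n : nat)
    (p_prime : prime p) (n_gt0 : (1 <= n)%N)
    (cycG : cyclic G) (cardG : #|G| = (p ^ n)%N) :
  let P : rat := p%:R in
  let B := sgb_graph G in
  [/\ (zagreb1 B)%:R =
        (P ^+ (2 * n) * (P ^+ 2 + 1) + P ^+ (4 * n) * (P ^+ 2 - 1) + 2)
          / (P ^+ 2 + 1),
      (zagreb2 B)%:R = (P ^+ (4 * n) * (P ^+ 2 - 1) + 2) / (P ^+ 2 + 1)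
    & (zagreb2 B)%:R / #|edges B|%:R >=
        (zagreb1 B)%:R / #|vertex B|%:R :> rat].
Proof.
move=> P B.
have P2_neq0 : P ^+ 2 + 1 != 0 by rewrite gt_eqF // ltr_wpDl ?sqr_ge0.
have M2 : (zagreb2 B)%:R = (P ^+ (4 * n) * (P ^+ 2 - 1) + 2) / (P ^+ 2 + 1).
  apply: (canRL (mulfK P2_neq0)).
  by rewrite zagreb2_sgb (sum_sqr_npairs_cyclic _ p_prime cycG cardG).
split=> //; last exact: sgb_zagreb_mean.
rewrite zagreb1_sgb -zagreb2_sgb natrD M2 cardG -expnM mulnC natrX.
by rewrite -addrA [RHS]mulrDl mulfK ?[(n * 2)%N]mulnC.
Qed.
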